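(* Let $D$ be a dendrite and let $f\colon D\to D$ be a continuous map. If there is a point $x\in D\setminus \mathrm{End}(D)$ such that $\overline{\mathrm{Orb}^+(x)}=D$, then the set of periodic points of $f$ is dense in $D$.
   Context: A continuum is a compact, connected, nonempty metric space. A dendrite is a continuum $D$ in which any two distinct points can be separated by a third point of $D$. A point of $D$ is an endpoint if it has order $1$, i.e. it has arbitrarily small open neighborhoods with one-point boundary; $\mathrm{End}(D)$ denotes the set of endpoints of $D$. For $f\colon D\to D$ continuous and $x\in D$, $\mathrm{Orb}^+(x)=\{f^n(x): n\in\mathbb{N}\}$. A point $x$ is periodic if $f^n(x)=x$ for some $n>0$. *)

(* Defs.v *)
From mathcomp Require Import all_boot all_order all_algebra.
From mathcomp Require Import all_classical all_reals.
From mathcomp Require Import topology.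

Set Implicit Arguments.
Unset Strict Implicit.
Unset Printing Implicit Defensive.

Local Open Scope classical_set_scope.

Definition continuum (R : realType) (D : metricType R) : Prop :=
  [/\ compact [set: D], connected [set: D] & [set: D] !=set0].

(* The equation A `|` B = [set~ z] forces z to be distinct from x and y. *)
Definition separates (T : topologicalType) (z x y : T) : Prop :=
  exists A B : set T,
    [/\ A x, B y, separated A B & A `|` B = [set~ z]].

Definition dendrite (R : realType) (D : metricType R) : Prop :=
  continuum D /\ forall x y : D, x <> y -> exists z : D, separates z x y.

Definition boundary (T : topologicalType) (A : set T) : set T :=
  closure A `\` interior A.

(* Points of order exactly 1: the one-point space has no endpoint, since there
   the boundary of every set is empty. *)
Definition endpoints (T : topologicalType) : set T :=
  [set x | forall V, nbhs x V ->
     exists U, [/\ open U, U x, U `<=` V & exists b, boundary U = [set b]]].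

Arguments endpoints : clear implicits.

Definition forward_orbit (T : Type) (f : T -> T) (x : T) : set T :=
  [set iter n f x | n in [set: nat]].

Definition periodic_points (T : Type) (f : T -> T) : set T :=
  [set x | exists n : nat, (0 < n)%N /\ iter n f x = x].

(* Main.v *)
Require Import Defs.
From mathcomp Require Import all_boot all_order all_algebra.
From mathcomp Require Import all_classical all_reals.
From mathcomp Require Import topology.

(* Let [x] be a cut point with dense orbit and let [O] be open and nonempty. By
   compactness some [u <> v] have all points lying between [u] and [v] (not cut off
   from [u] by [v], nor from [v] by [u]) in [O].
   If all of these points separate [u] from [v], they form an open interval, in
   which, without periodic points, each iterate of [f] moves every point to the same
   side. A point of the dense orbit in it has an iterate [f^m] on its right and an
   iterate [f^n] on its left, both in the interval, so [f^(mn)] moves it both ways.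
   Otherwise some cut point [c] carries a whole branch lying between [u] and [v].
   The cut points of [c] together with that branch form a connected set, and some
   image of it under an iterate of [f] contains [x]: there is a cut point [w] there
   whose orbit is dense. Hence some iterate of [f] sends [w] into the part of the
   branch beyond [w], and such an iterate has a fixed point at or beyond [w]. *)

Local Open Scope classical_set_scope.

Section Dendrite.
Context {T : topologicalType}.
Hypothesis closed_point : forall x : T, closed [set x].
Hypothesis T_connected : connected [set: T].
Hypothesis T_compact : compact [set: T].
Hypothesis sepT : forall x y : T, x <> y -> exists z, separates z x y.

Implicit Types (x y z t a b c p q : T).

(** * Separation and betweenness *)

Lemma clopen_full (W : set T) x : open W -> closed W -> W x -> forall y, W y.
Proof.
move=> oW cW Wx y; have -> // : W = setT.
by apply: T_connected; [exists x|exists W; rewrite ?setTI|exists W; rewrite ?setTI].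
Qed.

(** Points are closed, so each side is the complement of a closed set: the closure of the other side
    together with [t]. *)
Lemma separates_open {t x y} : separates t x y -> exists A B : set T,
  [/\ A x, B y & [/\ open A, open B, A `&` B = set0 & A `|` B = [set~ t]]].
Proof.
have opn A B : separated A B -> A `|` B = [set~ t] -> open A.
  move=> [_ AB0] ABt; suff -> : A = ~` (closure B `|` [set t]).
    by apply: closed_openC; apply: closedU => //; exact: closed_closure.
  apply/seteqP; split=> u /=; last first.
    move=> /not_orP[nBu /= ut]; have : [set~ t] u by [].
    by rewrite -ABt => -[//|/subset_closure].
  move=> Au [Bu|ut]; first by have : (A `&` closure B) u by []; rewrite AB0.
  by have : [set~ t] u by (rewrite -ABt; left).
move=> [A [B [Ax By sAB ABt]]]; exists A, B; split=> //; split=> //.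
- exact: opn sAB ABt.
- by apply: opn; [rewrite separatedC; exact: sAB|rewrite setUC].
- exact: separated_disjoint.
Qed.

Lemma open_separates {t x y} (A B : set T) : A x -> B y -> open A -> open B ->
  A `&` B = set0 -> A `|` B = [set~ t] -> separates t x y.
Proof.
move=> Ax By oA oB AB0 ABt; exists A, B; split=> //.
have dsj (C E : set T) : open E -> C `&` E = set0 -> closure C `&` E = set0.
  move=> oE CE0; apply/seteqP; split=> // u [/(_ E) + Eu].
  by move=> /(_ (open_nbhs_nbhs (conj oE Eu))); rewrite CE0 => -[].
by split; [apply: dsj|rewrite setIC; apply: dsj => //; rewrite setIC].
Qed.

Lemma separates_sym {t x y} : separates t x y -> separates t y x.
Proof.
move=> [A [B [Ax By sAB ABt]]]; exists B, A.
by split=> //; [rewrite separatedC|rewrite setUC].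
Qed.

Lemma separates_neql {t x y} : separates t x y -> x <> t.
Proof. by move=> [A [B [Ax _ _ ABt]]]; have : [set~ t] x by (rewrite -ABt; left). Qed.

Lemma separates_neqr {t x y} : separates t x y -> y <> t.
Proof. by move=> /separates_sym/separates_neql. Qed.

Lemma separates_neq {t x y} : separates t x y -> x <> y.
Proof.
move=> /separates_open[A [B [Ax By [_ _ AB0 _]]]] xy.
have : (A `&` B) x by (split=> //; rewrite xy).
by rewrite AB0.
Qed.

Lemma separates_split {t x y} z : separates t x y -> z <> t ->
  separates t x z \/ separates t z y.
Proof.
move=> [A [B [Ax By sAB ABt]]] zt.
have : [set~ t] z by []. rewrite -ABt => -[Az|Bz]; [right|left]; by exists A, B.
Qed.

(** The intersection of [B] and [E] is the complement of the union of [A] and [C]. It would be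
    clopen, containing [y] and missing [x]. *)
Lemma separates_asym {t x y} : separates t x y -> ~ separates x t y.
Proof.
move=> /separates_open[A [B [Ax By [oA oB AB0 ABt]]]].
move=> /separates_open[C [E [Ct Ey [oC oE CE0 CEx]]]].
suff /(_ x) [_ Ex] : forall u, (B `&` E) u.
  have : [set~ x] x by (rewrite -CEx; right).
  exact.
apply: (@clopen_full _ y) => //; first exact: openI.
suff -> : B `&` E = ~` (A `|` C) by apply: open_closedC; exact: openU.
apply/seteqP; split=> u /=.
  move=> [Bu Eu] [Au|Cu].
    by have : (A `&` B) u by []; rewrite AB0.
  by have : (C `&` E) u by []; rewrite CE0.
move=> /not_orP[nA nC]; split.
  have : [set~ t] u by move=> /= ut; apply: nC; rewrite ut.
  by rewrite -ABt => -[].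
have : [set~ x] u by move=> /= ux; apply: nA; rewrite ux.
by rewrite -CEx => -[].
Qed.

Local Ltac sep_absurd := exfalso; match goal with
  | H : separates ?t ?x ?y, K : separates ?x ?t ?y |- _ => exact: separates_asym H K
  | H : separates ?t ?x ?y, K : separates ?x ?y ?t |- _ =>
      exact: separates_asym H (separates_sym K)
  | H : separates ?t ?y ?x, K : separates ?x ?t ?y |- _ =>
      exact: separates_asym (separates_sym H) K
  | H : separates ?t ?y ?x, K : separates ?x ?y ?t |- _ =>
      exact: separates_asym (separates_sym H) (separates_sym K)
  | H : ~ separates ?t ?x ?y, K : separates ?t ?x ?y |- _ => exact: H K
  | H : ~ separates ?t ?x ?y, K : separates ?t ?y ?x |- _ => exact: H (separates_sym K)
  | K : separates ?t ?x ?x |- _ => exact: separates_neq K erefl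
  | K : separates ?t ?t ?x |- _ => exact: separates_neql K erefl
  | K : separates ?t ?x ?t |- _ => exact: separates_neqr K erefl
  end.

(** Read [separates s a t] as: on the way from [a], [s] comes strictly before [t]. This lemma and
    the next two are the rules of that order; in each, asymmetry excludes the wrong alternative of a
    split. *)
Lemma separates_trans {s t a b} : separates s a t -> separates t a b ->
  separates s a b /\ separates t s b.
Proof.
move=> sat tab.
have tsb : separates t s b.
  have [?|//] := separates_split _ tab (nesym (separates_neqr sat)); sep_absurd.
split=> //.
have [//|?] := separates_split _ sat (nesym (separates_neq tsb)); sep_absurd.
Qed.

Lemma separates_trans2 {s t a b} : separates s a t -> separates t s b ->
  separates s a b /\ separates t a b.
Proof.
move=> sat tsb; split.
  have [//|?] := separates_split _ sat (nesym (separates_neq tsb)); sep_absurd.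
have [?|//] := separates_split _ tsb (separates_neq sat); sep_absurd.
Qed.

Lemma separates_total {s t a b} : separates s a b -> separates t a b -> s <> t ->
  separates s a t \/ separates t a s.
Proof.
move=> sab tab st.
have [|?] := separates_split _ sab (nesym st); first by left.
have [|?] := separates_split _ tab st; [by right|sep_absurd].
Qed.

Lemma connected_separates {M : set T} {t a b} : connected M -> M a -> M b ->
  separates t a b -> M t.
Proof.
move=> cM Ma Mb [A [B [Aa Bb sAB ABt]]]; apply: contrapT => nMt.
have [|MA|MB] := connected_subset sAB _ cM.
- by rewrite ABt => u Mu /= ut; apply: nMt; rewrite -ut.
- have AB0 := separated_disjoint sAB; have : (A `&` B) b by (split=> //; apply: MA).
  by rewrite AB0.
- have AB0 := separated_disjoint sAB; have : (A `&` B) a by (split=> //; apply: MB).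
  by rewrite AB0.
Qed.

(** For [b] other than [t], this is the quasicomponent of [b] in the complement of [t]. *)
Definition same_side t b : set T := [set y | y <> t /\ ~ separates t y b].

Lemma open_opposite t b : open [set y | separates t y b].
Proof.
rewrite openE => y /separates_open[A [B [Ay Bb [oA oB AB0 ABt]]]].
apply: (@filterS _ _ _ A); last exact: open_nbhs_nbhs.
by move=> u Au; apply: open_separates oA oB AB0 ABt.
Qed.

(** Let [e] separate [t] from [y]. The points that [e] cuts off from [t] form a neighborhood of [y],
    and [t] does not split it: by asymmetry [t] separates none of them from [e]. *)
Lemma open_same_side t b : open (same_side t b).
Proof.
rewrite openE => y [yt nyb].
have [e ety] := sepT _ _ (nesym yt).
apply: (@filterS _ _ _ [set u | separates e u t]); last first.
  by apply: open_nbhs_nbhs; split; [exact: open_opposite|exact: separates_sym].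
move=> u /= eut; split; first exact: separates_neq eut.
move=> tub; have [tuy|//] := separates_split _ tub yt.
have [?|?] := separates_split _ tuy (nesym (separates_neqr eut)); sep_absurd.
Qed.

(* If there were no such [c], the union of the sets [same_side c z], for [c]
   between [a] and [z], would be a clopen subset of the complement of [a] containing [z] but not [b]. *)
Lemma same_side_branch {a z b} : a <> z -> a <> b -> ~ separates a z b ->
  exists c, separates c a z /\ same_side c z b.
Proof.
move=> az ab nazb; apply: contrapT => H; apply: nazb.
pose P := \bigcup_(c in [set c | separates c a z]) same_side c z.
have Pa : ~ P a by move=> [c /= caz [_ ncaz]]; apply: ncaz.
have Pz : P z.
  have [c caz] := sepT _ _ az; exists c => //; split; first exact: separates_neqr caz.
  by move=> /separates_neq.
have Pb : ~ P b.
  by move=> [c /= caz Qb]; apply: H; exists c; split=> //.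
apply: (@open_separates _ _ _ P (~` (P `|` [set a]))) => //.
- by move=> [|/nesym].
- by apply: bigcup_open => c _; exact: open_same_side.
(* With [d] separating [a] from [y], the neighborhood [same_side d y] misses [P]: a common point [u]
   would put [y] itself into [P], through [c] or through [d]. *)
- rewrite openE => y /not_orP[nPy /= ya].
  have [d day] := sepT _ _ (nesym ya).
  apply: (@filterS _ _ _ (same_side d y)); last first.
    apply: open_nbhs_nbhs; split; first exact: open_same_side.
    by split=> [|/separates_neq//]; exact: separates_neqr day.
  move=> u [ud nduy] /= [[c /= caz [uc ncuz]]|ua]; last by apply: nduy; rewrite ua.
  have [cd|cd] := pselect (c = d).
    subst c; apply: nPy; exists d => //; split; first exact: separates_neqr day.
    by move=> dyz; have [?|?] := separates_split _ dyz ud; sep_absurd.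
  have ndcy : ~ separates d c y.
    move=> dcy; have [dcu|?] := separates_split _ dcy ud; last by sep_absurd.
    apply: nPy; exists c => //; split; first exact: nesym (separates_neq dcy).
    move=> cyz; have [cyu|?] := separates_split _ cyz uc; last by sep_absurd.
    by have [?|?] := separates_split _ cyu (nesym cd); sep_absurd.
  have [dac|//] := separates_split _ day cd.
  have [?|cdz] := separates_split _ caz (nesym cd); first by sep_absurd.
  have [daz _] := separates_trans2 dac cdz.
  apply: nPy; exists d => //; split; first exact: separates_neqr day.
  by move=> dyz; have [?|?] := separates_split _ dyz cd; sep_absurd.
- by apply/seteqP; split=> // u [? []]; left.
- apply/seteqP; split=> u /=; first by move=> [Pu ua|/not_orP[]//]; apply: Pa; rewrite -ua.
  by move=> ua; have [|nP] := pselect (P u); [left|right; case].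
Qed.

(** * Arcs and the order of the tree with a chosen root *)

(** [arc z b a] doubles as the order of the tree rooted at [z]: [a] lies at or before [b]. *)
Definition arc p q : set T := [set t | t = p \/ t = q \/ separates t p q].

Definition between p q : set T := same_side p q `&` same_side q p.

Lemma arc_trans {z a b c} : arc z b a -> arc z c b -> arc z c a.
Proof.
move=> [->|[->//|azb]] [bz|[bc|bzc]]; try by left.
- by subst b; sep_absurd.
- by subst c; right; right.
- by right; right; case: (separates_trans azb bzc).
Qed.

Lemma arc_anti {z a b} : arc z b a -> arc z a b -> a = b.
Proof.
move=> [->|[->//|azb]] [bz|[ba|bza]] //; try by sep_absurd.
by subst b; sep_absurd.
Qed.

(** Some [c] cuts [a] off from [z] but has [b] on the side of [z]. Both conditions are open, so the
    rooted order is a closed relation. *)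
Lemma not_arc_nbhs {z a b} : ~ arc z b a -> exists A B : set T,
  [/\ open A, open B, A a, B b & forall x y, A x -> B y -> ~ arc z y x].
Proof.
move=> /not_orP[az /not_orP[ab nazb]].
have [c [caz Qb]] := same_side_branch az ab nazb.
exists [set x | separates c x z], (same_side c z); split => //.
- exact: open_opposite.
- exact: open_same_side.
move=> x y /= cxz [yc ncyz] [xz|[xy|xzy]].
- by subst x; sep_absurd.
- by subst x; sep_absurd.
- have [cxy|?] := separates_split _ cxz yc; last by sep_absurd.
  by have [?|?] := separates_split _ xzy (nesym (separates_neql cxz)); sep_absurd.
Qed.

Lemma closed_arc z (g h : T -> T) : continuous g -> continuous h ->
  closed [set y | arc z (g y) (h y)].
Proof.
move=> cg ch; rewrite -[X in closed X]setCK; apply: open_closedC.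
rewrite openE => y /= /not_arc_nbhs[A [B [oA oB Ah Bg AB]]].
have nA : nbhs y (h @^-1` A) by apply: ch; exact: open_nbhs_nbhs.
have nB : nbhs y (g @^-1` B) by apply: cg; exact: open_nbhs_nbhs.
by apply: filterS (filterI nA nB) => u [Au Bu]; exact: AB.
Qed.

Lemma closed_beyond z a : closed [set y | arc z y a].
Proof. by apply: (@closed_arc z id (fun=> a)) => x; [exact: cvg_id|exact: cvg_cst]. Qed.

Lemma arc_closed p q : closed (arc p q).
Proof. by apply: (@closed_arc p (fun=> q) id) => x; [exact: cvg_cst|exact: cvg_id]. Qed.

(** Zorn's lemma for the order rooted at [z]: the parts of [F] beyond the members of a chain are
    closed and form a filter base, and by compactness a cluster point bounds the chain. *)
Lemma arc_maximal z (F : set T) y0 : closed F -> F y0 ->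
  exists m, F m /\ forall y, F y -> arc z y m -> y = m.
Proof.
move=> cF Fy0.
pose R (s t : {y | F y}) : bool := `[< arc z (sval t) (sval s) >].
have [|||C totC|m mmax] := @Zorn {y | F y} R.
- by move=> t; apply/asboolP; right; left.
- move=> r s t /asboolP rs /asboolP st; apply/asboolP; exact: arc_trans rs st.
- move=> [s Fs] [t Ft] /asboolP /= st /asboolP /= ts.
  by have ts' := arc_anti ts st; subst t; congr exist; exact: Prop_irrelevance.
- have [[c0 Cc0]|C0] := pselect (C !=set0); last first.
    by exists (exist _ y0 Fy0) => s Cs; case: C0; exists s.
  pose G (c : {y | F y}) : set T := [set y | F y /\ arc z y (sval c)].
  have FG : Filter (filter_from C G).
    apply: filter_from_filter; first by exists c0.
    move=> i j Ci Cj; have [/asboolP ij|/asboolP ji] := totC _ _ Ci Cj.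
      by exists j => // y [Fy yj]; split; split => //; exact: arc_trans ij yj.
    by exists i => // y [Fy yi]; split; split => //; exact: arc_trans ji yi.
  have PG : ProperFilter (filter_from C G).
    apply: filter_from_proper => c _; exists (sval c); split; first exact: (svalP c).
    by right; left.
  have [y [_ cly]] := T_compact _ PG filterT.
  have Gy i : C i -> G i y.
    move=> Ci; have : closed (G i).
      exact: closedI cF (closed_beyond z (sval i)).
    by apply; move: cly; rewrite clusterE; apply; exists i.
  have Fy : F y by case: (Gy _ Cc0).
  by exists (exist _ y Fy) => s Cs; apply/asboolP; case: (Gy _ Cs).
- exists (sval m); split; first exact: (svalP m).
  move=> y Fy my; have := mmax (exist _ y Fy) (asboolT my).
  by move=> <-.
Qed.

(** As [r] tends to [p] along the arc from [q], the regions [between p r] eventually leave the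
    compact complement of [U]. *)
Lemma between_sub_nbhs {p q} {U : set T} : open U -> U p -> q <> p ->
  exists r, separates r p q /\ between p r `<=` U.
Proof.
move=> oU Up qp.
pose B (t : T) : set T := [set r | r = t \/ separates r p t].
pose F := filter_from [set t | separates t p q] B.
have [t0 t0pq] := sepT _ _ (nesym qp).
have FF : Filter F.
  apply: filter_from_filter; first by exists t0.
  have sub s t : s = t \/ separates s p t -> B s `<=` B t `&` B s.
    move=> st r rs; split=> //; case: rs st => [-> //|rps [<-|spt]].
      by right.
    by right; case: (separates_trans rps spt).
  move=> i j /= ipq jpq; have [<-|ij] := pselect (i = j).
    by exists i => //; apply: sub; left.
  have [ipj|jpi] := separates_total ipq jpq ij.
    by exists i => //; rewrite setIC; apply: sub; right.
  by exists j => //; apply: sub; right.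
(* By compactness it suffices to give each [k] outside [U] a neighborhood that misses [between p r]
   for all [r] close to [p]. *)
have : \near F, ~` U `<=` (fun y => ~ between p F y).
  have cU : compact (~` U).
    by apply: subclosed_compact T_compact _ => //; exact: open_closedC.
  apply: (iffLR (compact_near_coveringP _) cU T F (fun r y => ~ between p r y)) => k /= nUk.
  have kp : k <> p by move=> kp; apply: nUk; rewrite kp.
  (* Either [k] lies behind [p] as seen from [q], or some [c] on the arc cuts [p] off from both [q]
     and [k]; then [r] at or before [c] suffices. *)
  have [pkq|npkq] := pselect (separates p k q).
    exists ([set y | separates p y q], [set t | separates t p q]).
      split; first by apply: open_nbhs_nbhs; split=> //; exact: open_opposite.
      exists t0 => // r [->//|rpt]; exact: (separates_trans rpt t0pq).1.
    move=> [y r] /= [pyq rpq] [[yp npyr] _].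
    by have [?|?] := separates_split _ pyq (nesym (separates_neql rpq)); sep_absurd.
  have [|c [cpq Qk]] := same_side_branch (nesym qp) (nesym kp).
    by move=> /separates_sym.
  exists (same_side c q, B c).
    split; first by apply: open_nbhs_nbhs; split=> //; exact: open_same_side.
    by exists c.
  move=> [y r] /= [[yc ncyq] Br] [_ [yr nryp]].
  have [cpy|?] := separates_split _ cpq yc; last by sep_absurd.
  case: Br => [rc|rpc]; first by subst r; sep_absurd.
  by have [? _] := separates_trans rpc cpy; sep_absurd.
move=> [t tpq H]; exists t; split=> // y bty; apply: contrapT => nUy.
by apply: (H t _ y) => //; left.
Qed.

Lemma separates_near {p q} {U : set T} : open U -> U p -> q <> p ->
  exists t, separates t p q /\ U t.
Proof.
move=> oU Up qp; have [r [rpq brU]] := between_sub_nbhs oU Up qp.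
have [t tpr] := sepT _ _ (separates_neql rpq).
exists t; split; first exact: (separates_trans tpr rpq).1.
apply: brU; split; split.
- exact: nesym (separates_neql tpr).
- by move=> ?; sep_absurd.
- exact: nesym (separates_neqr tpr).
- by move=> ?; sep_absurd.
Qed.

(** If the arc splits into closed parts [P] and [Q] with [p] in [P] and [b] in [Q], take the last
    point [a] of [P] on the way to [b]. Points just after [a] avoid the closed set [Q], hence lie in
    [P], against the choice of [a]. *)
Lemma arc_connected p q : connected (arc p q).
Proof.
have key (P Q : set T) : closed P -> closed Q -> P `&` Q = set0 ->
    arc p q = P `|` Q -> P p -> Q = set0.
  move=> cP cQ PQ0 apq Pp; apply/seteqP; split=> // b Qb.
  have cF : closed (P `&` arc p b).
    exact: closedI cP (arc_closed p b).
  have [|a [[Pa ab] amax]] := arc_maximal p _ p cF; first by split=> //; left.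
  have nQa : ~ Q a by move=> Qa; have : (P `&` Q) a by []; rewrite PQ0.
  have ba : b <> a by move=> ba; apply: nQa; rewrite -ba.
  have [t [tab nQt]] := separates_near (closed_openC cQ) nQa ba.
  have tpb : arc p b t.
    right; right; case: ab => [<-//|[/esym//|apb]].
    exact: separates_sym (separates_trans (separates_sym tab) (separates_sym apb)).1.
  have : arc p q t by apply: arc_trans tpb _; rewrite apq; right.
  rewrite apq => -[Pt|//].
  apply: (separates_neql tab); apply/esym; apply: amax => //.
  case: ab => [->|[/esym//|apb]]; first by left.
  right; right; apply: separates_sym.
  exact: (separates_trans (separates_sym tab) (separates_sym apb)).2.
have carc := arc_closed p q.
move=> B [b Bb] [O oO BO] [C cC BC].
have cB : closed B by rewrite BC; exact: closedI.
have cB' : closed (arc p q `&` ~` O) by apply: closedI => //; exact: open_closedC.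
have arcE : arc p q = B `|` (arc p q `&` ~` O).
  by rewrite {1}BO -setIUr setUv setIT.
have BI : B `&` (arc p q `&` ~` O) = set0.
  by rewrite {1}BO setIACA setICr setI0.
have [Bp|nBp] := pselect (B p).
  by rewrite [RHS]arcE (key _ _ cB cB' BI arcE Bp) setU0.
have B0 : B = set0.
  apply: (key _ _ cB' cB); [by rewrite setIC|by rewrite setUC|].
  have : arc p q p by left.
  by rewrite {1}arcE => -[].
by move: Bb; rewrite B0.
Qed.

(** Among the points [u] at or beyond [y] that [h] does not move off the part beyond [u], take a
    maximal [m]. If [h m] differs from [m], put [d] between them; by continuity a point [t] slightly
    beyond [m] is before [d] while [h t] is beyond [d], against maximality. *)
Lemma fixed_point_beyond (h : T -> T) z y : continuous h -> arc z (h y) y ->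
  exists t, h t = t /\ arc z t y.
Proof.
move=> ch zy.
have cF : closed ([set u | arc z (h u) u] `&` [set u | arc z u y]).
  by apply: closedI (closed_beyond z y); apply: (@closed_arc z h id) => // x; exact: cvg_id.
have [|m [[/= zm ym] mmax]] := arc_maximal z _ y cF.
  by split=> //; right; left.
exists m; split=> //; apply: contrapT => hm.
have [d dmh] := sepT _ _ (nesym hm).
have zdh : separates d z (h m).
  case: zm => [<-//|[/esym//|mzh]].
  exact: separates_sym (separates_trans (separates_sym dmh) (separates_sym mzh)).1.
have oV : open (h @^-1` same_side d (h m)).
  by apply: open_comp => [u _|]; [exact: ch|exact: open_same_side].
have [|t [tmd [htd nd]]] := separates_near oV _ (nesym (separates_neql dmh)).
  split; first exact: separates_neqr dmh.
  by move=> ?; sep_absurd.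
have dzt : separates d z (h t).
  by have [//|?] := separates_split _ zdh htd; sep_absurd.
have tzd_mzt : separates t z d /\ arc z t m.
  case: zm => [mz|[/esym//|mzh]]; first by subst m; split=> //; left.
  have mdz := (separates_trans (separates_sym dmh) (separates_sym mzh)).2.
  have [tdz mtz] := separates_trans (separates_sym tmd) mdz.
  by split; [|right; right]; exact: separates_sym.
case: tzd_mzt => tzd mt.
apply: (separates_neql tmd); apply/esym; apply: mmax => //; split; last first.
  exact: arc_trans ym mt.
by right; right; case: (separates_trans tzd dzt).
Qed.

(** * Regions between two points, their branches, and endpoints *)

Lemma between_open p q : open (between p q).
Proof. by apply: openI; exact: open_same_side. Qed.

Lemma same_side_convex {u v s t y} : same_side u v s -> same_side u v t ->
  v <> u -> separates y s t -> same_side u v y.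
Proof.
move=> [su nsv] [tu ntv] vu yst.
have nust : ~ separates u s t.
  by move=> ust; have [?|?] := separates_split _ ust vu; sep_absurd.
split=> [yu|uyv]; first by subst y.
have [uys|?] := separates_split _ uyv su; last by sep_absurd.
have [uyt|?] := separates_split _ uyv tu; last by sep_absurd.
by have [?|?] := separates_split _ yst (nesym (separates_neql uyv)); sep_absurd.
Qed.

(** This places a periodic point found on the branch at [c], or at [c] itself, inside the region. *)
Lemma between_branch {u v y c t} : between u v y -> separates c y u ->
  same_side c u v -> t = c \/ separates c t u -> between u v t.
Proof.
move=> [[yu nuyv] [yv nvyu]] cyu [vc ncvu] tc.
have uc := separates_neqr cyu.
have nucv : ~ separates u c v.
  by move=> ucv; have [?|?] := separates_split _ ucv yu; sep_absurd.
have [cyv|?] := separates_split _ cyu vc; last by sep_absurd.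
have nvcu : ~ separates v c u.
  by move=> vcu; have [?|?] := separates_split _ vcu yv; sep_absurd.
case: tc => [->|ctu]; first by split; split=> //; exact: nesym.
have [ctv|?] := separates_split _ ctu vc; last by sep_absurd.
split; split.
- exact: separates_neq ctu.
- by move=> utv; have [?|?] := separates_split _ utv (nesym uc); sep_absurd.
- exact: separates_neq ctv.
- by move=> vtu; have [?|?] := separates_split _ vtu (nesym vc); sep_absurd.
Qed.

(** Since [x] separates nothing, the side of [x] at a nearby [r] lies in [between x r] up to [x]
    itself, hence is small; its boundary is [r]. *)
Lemma noncut_endpoint {x q} : q <> x -> (forall a b, ~ separates x a b) ->
  endpoints T x.
Proof.
move=> qx ncut V nV.
have Vx := nbhs_singleton (nbhs_interior nV).
have [r [rxq brV]] := between_sub_nbhs (open_interior V) Vx qx.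
have xr := separates_neql rxq.
have Ux : same_side r x x by split=> // /separates_neq.
exists (same_side r x); split=> //.
- exact: open_same_side.
- move=> y ry; have [->|yx] := pselect (y = x); first exact: nbhs_singleton.
  by apply: interior_subset; apply: brV.
exists r; rewrite /boundary (iffLR (interior_id _) (open_same_side r x)).
have Uc y : closure (same_side r x) y -> same_side r x y \/ y = r.
  move=> cy; apply: contrapT => /not_orP[nU yr].
  have ryx : separates r y x by apply: contrapT => nryx; apply: nU.
  have [z [/= [_ nrzx] rzx]] := cy _ (open_nbhs_nbhs (conj (open_opposite r x) ryx)).
  exact: nrzx rzx.
apply/seteqP; split=> y /=; first by move=> [/Uc[]].
move=> ->; split; last by case.
(* If [r] were not in the closure, the side would be clopen without being everything. *)
apply: contrapT => ncr.
have cU : closed (same_side r x).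
  by move=> z cz; have [//|zr] := Uc z cz; move: cz; rewrite zr.
by have [] := clopen_full _ x (open_same_side r x) cU Ux r.
Qed.

(** * Points with dense orbit *)

(** Asking for arbitrarily late visits makes the notion pass to iterates of [x] and gives visits at
    positive times. *)
Definition transitive_point (f : T -> T) x :=
  forall W : set T, open W -> W !=set0 -> forall k, exists2 j, (k <= j)%N & W (iter j f x).

(** An open set reduced to one point would be clopen, so a space with two points has no isolated
    point. *)
Lemma open_remove_point {p q : T} (W : set T) y : p <> q -> open W -> W !=set0 ->
  open (W `&` [set~ y]) /\ W `&` [set~ y] !=set0.
Proof.
move=> pq oW [w Ww]; split; first by apply: openI => //; exact: closed_openC.
apply: contrapT => H; apply: pq.
have WE z : W z -> z = y by move=> Wz; apply: contrapT => zy; apply: H; exists z.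
have wy : w = y by exact: WE.
subst w; have cW : closed W.
  suff -> : W = [set y] by exact: closed_point.
  by apply/seteqP; split=> z /=; [exact: WE|move=> ->].
have fW := clopen_full W y oW cW Ww.
by rewrite (WE p (fW p)) (WE q (fW q)).
Qed.

(** To exclude a visit at time [k], remove [iter k f x] from the target. *)
Lemma dense_orbit_transitive {p q : T} f x : p <> q ->
  closure (forward_orbit f x) = [set: T] -> transitive_point f x.
Proof.
move=> pq dx W oW W0 k; elim: k W oW W0 => [|k IH] W oW W0.
  have [w Ww] := W0; have : closure (forward_orbit f x) w by rewrite dx.
  by move=> /(_ _ (open_nbhs_nbhs (conj oW Ww)))[_ [[j _ <-] Wj]]; exists j.
have [oW' W'0] := open_remove_point W (iter k f x) pq oW W0.
have [j kj [Wj jk]] := IH _ oW' W'0; exists j => //.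
by rewrite ltn_neqAle kj andbT; apply/eqP => kj'; apply: jk; rewrite kj'.
Qed.

Lemma transitive_point_iter f x k : transitive_point f x -> transitive_point f (iter k f x).
Proof.
move=> tx W oW W0 i; have [j ij Wj] := tx W oW W0 (i + k)%N.
exists (j - k)%N; first by rewrite leq_subRL ?(leq_trans _ ij) ?leq_addl // addnC.
by rewrite -iterD subnK // (leq_trans _ ij) // leq_addl.
Qed.

Lemma transitive_point_preimage f x w i : iter i f w = x -> transitive_point f x ->
  transitive_point f w.
Proof.
move=> <- tx W oW W0 k; have [j kj Wj] := tx W oW W0 k.
by exists (j + i)%N; rewrite ?iterD // (leq_trans kj) // leq_addr.
Qed.

(** A periodic orbit is finite, and removing its points one by one leaves a nonempty open set that
    it never visits. *)
Lemma transitive_point_aperiodic {p q : T} f x n : p <> q -> transitive_point f x ->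
  (0 < n)%N -> iter n f x <> x.
Proof.
move=> pq tx n0 fx.
have mod m : exists2 i, (i < n)%N & iter m f x = iter i f x.
  elim: m => [|m [i im /= ->]]; first by exists 0%N.
  have [in'|] := ltnP i.+1 n; first by exists i.+1.
  rewrite leq_eqVlt ltnNge im orbF => /eqP ni; exists 0%N => //=.
  by rewrite -iterS -ni fx.
have [W [oW W0 HW]] : exists W : set T, [/\ open W, W !=set0 &
    forall i, (i < n)%N -> ~ W (iter i f x)].
  elim: (n) => [|m [W [oW W0 HW]]]; first by exists setT; split=> //; [exact: openT|exists x].
  have [oW' W'0] := open_remove_point W (iter m f x) pq oW W0.
  exists (W `&` [set~ iter m f x]); split=> // i.
  by rewrite ltnS leq_eqVlt => /orP[/eqP-> [_ /(_ erefl)]|/HW nW [/nW]].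
have [j _ Wj] := tx W oW W0 0%N.
by have [i ilt ji] := mod j; apply: (HW i ilt); rewrite -ji.
Qed.

Lemma continuous_iter (f : T -> T) n : continuous f -> continuous (iter n f).
Proof.
move=> cf; elim: n => [|n IH] x /=; first exact: cvg_id.
by apply: continuous_comp; [exact: IH|exact: cf].
Qed.

Lemma connected_image (g : T -> T) (M : set T) : continuous g -> connected M ->
  connected (g @` M).
Proof.
by move=> cg cM; apply: connected_continuous_connected => //; exact: continuous_subspaceT.
Qed.

(* If no [f^i G] contains the cut point [x], then [f^n] preserves the trace on
   [\bigcup_i f^i G] of each side of [x], because [f^i G] and [f^(i+n) G] meet;
   as [x] is in the closure of both traces, [f^n x] is on neither side. *)
Lemma cut_point_in_orbit {f : T -> T} {G : set T} {n w x a b} : continuous f ->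
  connected G -> G w -> G (iter n f w) ->
  (forall W : set T, open W -> W !=set0 -> exists g i, G g /\ W (iter i f g)) ->
  separates x a b -> iter n f x <> x -> exists g i, G g /\ iter i f g = x.
Proof.
move=> cf cG Gw Gfw dG xab fxx; apply: contrapT => H.
have cfi i : continuous (iter i f) by exact: continuous_iter.
have same g i : G g -> ~ separates x (iter i f g) (iter n f (iter i f g)).
  move=> Gg xgg.
  have cM : connected (iter i f @` G `|` iter (n + i) f @` G).
    apply: connectedU; [|exact: connected_image..].
    exists (iter i f (iter n f w)); split; first by exists (iter n f w).
    by exists w => //; rewrite -iterD addnC.
  have := connected_separates cM _ _ xgg; case.
  - by left; exists g.
  - by right; exists g => //; rewrite iterD.
  - by move=> [g' Gg' g'x]; apply: H; exists g', i.
  - by move=> [g' Gg' g'x]; apply: H; exists g', (n + i)%N.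
have [oA oB] := (open_opposite x b, open_same_side x b).
have oP (W : set T) : open W -> open (iter n f @^-1` W).
  by move=> oW; apply: open_comp => [z _|//]; exact: cfi.
have nA : ~ separates x (iter n f x) b.
  move=> Afx; have [t [txb At]] := separates_near (oP _ oA) Afx (separates_neqr xab).
  have Bt : same_side x b t.
    by split=> [|?]; [exact: nesym (separates_neql txb)|sep_absurd].
  have [|g [i [Gg [Ag [gx ngb]]]]] := dG _ (openI (oP _ oA) oB); first by exists t.
  by have ngg := same g i Gg; have [?|?] := separates_split _ Ag gx; sep_absurd.
have Bfx : same_side x b (iter n f x) by [].
have [t [txa Bt]] := separates_near (oP _ oB) Bfx (separates_neql xab).
have At : separates x t b.
  by have [?|//] := separates_split t xab (nesym (separates_neql txa)); sep_absurd.
have [|g [i [Gg [[gx ngb] Ag]]]] := dG _ (openI (oP _ oB) oA); first by exists t.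
by have ngg := same g i Gg; have [?|?] := separates_split _ Ag gx; sep_absurd.
Qed.

Lemma branch_periodic {p q : T} {f : T -> T} {x a b c u y} : p <> q -> continuous f ->
  transitive_point f x -> separates x a b -> separates c y u ->
  exists t n, [/\ (0 < n)%N, iter n f t = t & t = c \/ separates c t u].
Proof.
move=> pq cf tx xab cyu.
have cfi i : continuous (iter i f) by exact: continuous_iter.
have cu := separates_neqr cyu.
pose O := [set w | separates c w u].
have oO : open O by exact: open_opposite.
have O0 : O !=set0 by exists y.
(* Only cut points are kept, so that something remains beyond each of them as seen from [u]. *)
pose G := [set w | (w = c \/ O w) /\ exists a b, separates w a b].
have Gc : G c by split; [left|exists y, u].
have cut_in w t : O w -> separates t w c -> O t /\ G t.
  move=> Ow twc; have [ctw|ctu] := separates_split t Ow (nesym (separates_neqr twc)).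
    by sep_absurd.
  by split=> //; split; [right|exists w, c].
have Gd w (W : set T) : O w -> open W -> W w -> exists g, G g /\ W g.
  move=> Ow oW Ww; have [t [twc Wt]] := separates_near oW Ww (nesym (separates_neql Ow)).
  by exists t; split=> //; case: (cut_in w t).
have cG : connected G.
  (* The arc from [c] to a point of [G] stays in [G], so [G] is a union of arcs through [c]. *)
  have -> : G = \bigcup_(w in G) arc c w.
    apply/seteqP; split=> [w Gw|t [w Gw]]; first by exists w => //; right; left.
    move=> [->//|[->//|tcw]].
    case: Gw => -[wc|Ow] _; first by subst w; sep_absurd.
    by case: (cut_in w t) => //; exact: separates_sym.
  apply: bigcup_connected; last by move=> w _; exact: arc_connected.
  by exists c => w _; left.
have [k _ Ok] := tx O oO O0 0%N.
have [j kj Oj] := tx O oO O0 k.+1.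
set o := iter k f x in Ok.
pose n := (j - k)%N.
have n0 : (0 < n)%N by rewrite subn_gt0.
have on : O (iter n f o) by rewrite /o -iterD subnK // ltnW.
have fG : connected (iter n f @` G) by exact: connected_image.
have [w [Gw Gfw]] : exists w, G w /\ G (iter n f w).
  have [g [Gg Og]] := Gd o _ Ok (open_comp (fun z _ => cfi n z) oO) on.
  (* Otherwise, [G] being dense in [O], [iter n f] is constant on [O]; its values at [iter k f x]
     and [iter j f x] agree, so it fixes [iter j f x]. *)
  have [g' [Gg' gg']] : exists g', G g' /\ iter n f g' <> iter n f g.
    apply: contrapT => H.
    have cst w : O w -> iter n f w = iter n f g.
      move=> Ow; apply: contrapT => wg.
      have oV : open (iter n f @^-1` [set~ iter n f g]).
        by apply: open_comp => [z _|]; [exact: cfi|exact: closed_openC].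
      by have [g' [Gg' ?]] := Gd w _ Ow oV wg; apply: H; exists g'.
    have tp := transitive_point_iter f x (n + k) tx.
    apply: (transitive_point_aperiodic f _ n pq tp n0).
    have nkj : (n + k = j)%N := subnK (ltnW kj).
    by rewrite {1}nkj (cst _ Oj) iterD (cst _ Ok).
  (* The cut point [t] belongs to the image of [G]. If [t] is outside the branch, then [c] separates
     it from [iter n f g], and [c] belongs to the image instead. *)
  have [t tgg] := sepT _ _ (nesym gg').
  have imt : (iter n f @` G) t.
    by apply: connected_separates fG _ _ tgg; [exists g|exists g'].
  have [[w Gw wt]|Hc] := pselect (exists2 w, G w & G (iter n f w)); first by exists w.
  case: (Hc); case: imt => w Gw wt; exists w => //; rewrite wt.
  have cut_t : exists a b, separates t a b by exists (iter n f g), (iter n f g').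
  split=> //; have [tc|tc] := pselect (t = c); first by left.
  have [cgt|?] := separates_split _ Og tc; last by right.
  have [cgg _] := separates_trans cgt tgg.
  have [w' Gw' w'c] : (iter n f @` G) c.
    by apply: connected_separates fG _ _ cgg; [exists g|exists g'].
  by case: Hc; exists w' => //; rewrite w'c.
have dG (W : set T) : open W -> W !=set0 -> exists g i, G g /\ W (iter i f g).
  move=> oW W0; have [m _ Wm] := transitive_point_iter f x k tx W oW W0 0%N.
  have oV : open (iter m f @^-1` W) by apply: open_comp => [z _|//]; exact: cfi.
  by have [g [Gg Wg]] := Gd o _ Ok oV Wm; exists g, m.
have nper := transitive_point_aperiodic f x n pq tx n0.
have [w' [i [Gw' w'x]]] := cut_point_in_orbit cf cG Gw Gfw dG xab nper.
have tw := transitive_point_preimage f x w' i w'x tx.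
case: Gw' => w'O [d [e w'de]].
have w'u : u <> w'.
  by case: w'O => [->//|Ow']; exact: nesym (separates_neq Ow').
(* Of the two points [d] and [e] that [w'] separates, one is cut off from [u]. *)
have bey : [set t | separates w' t u] !=set0.
  by have [|] := separates_split u w'de w'u; [exists d|move=> /separates_sym ?; exists e].
have [m m0 wm] := tw _ (open_opposite w' u) bey 1%N.
have [|t [mt]] := fixed_point_beyond (iter m f) u w' (cfi m).
  by right; right; exact: separates_sym.
move=> uwt; exists t, m; split=> //.
case: uwt => [?|[<-//|w'ut]]; first by case: w'u.
right; case: w'O => [<-|Ow']; first exact: separates_sym.
exact: separates_sym (separates_trans (separates_sym Ow') w'ut).1.
Qed.

(** * Free intervals *)

(** No branch leaves the arc, so the region is an open interval running from [u] to [v];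
    [separates y u (h y)] then says that [h] moves [y] to the right. *)
Definition free u v := forall y, between u v y -> separates y u v.

Lemma between_sym {u v y} : between u v y -> between v u y.
Proof. by case. Qed.

Lemma free_sym {u v} : free u v -> free v u.
Proof. by move=> fuv y /between_sym/fuv/separates_sym. Qed.

(** A point cut off by [t] from both ends would sit on a side branch at [t]. *)
Lemma free_sides {u v t y} : free u v -> between u v t -> separates t u y ->
  ~ separates t y v.
Proof.
move=> fuv It tuy tyv; have tuv := fuv t It.
have yuv : separates y u v.
  apply: fuv; split; split.
  - exact: nesym (separates_neq tuy).
  - move=> uyv.
    by have [?|?] := separates_split t uyv (nesym (separates_neql tuv)); sep_absurd.
  - exact: separates_neq tyv.
  - move=> vyu.
    by have [?|?] := separates_split t vyu (nesym (separates_neqr tuv)); sep_absurd.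
by have [_ ?] := separates_trans tuy yuv; sep_absurd.
Qed.

(** Choose [e] between [t] and [h t]: for [s] near [t], [s] stays left of [e] and [h s] stays right
    of it. *)
Lemma moves_right_open {u v} {h : T -> T} {t} : free u v -> continuous h ->
  between u v t -> separates t u (h t) ->
  exists N : set T, [/\ open N, N t & forall s, N s -> between u v s -> separates s u (h s)].
Proof.
move=> fuv ch It tuh.
have [e [eth Ie]] := separates_near (between_open u v) It (separates_neqr tuh).
have [ehu teu] := separates_trans (separates_sym eth) (separates_sym tuh).
have euv := fuv e Ie.
exists ([set s | separates e s (h t)] `&` h @^-1` same_side e (h t)); split.
- apply: openI; first exact: open_opposite.
  by apply: open_comp => [z _|]; [exact: ch|exact: open_same_side].
- by split=> //; split; [exact: separates_neqr eth|move=> ?; sep_absurd].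
move=> s [/= esh [hse nehs]] Is; have suv := fuv s Is.
have nehv := free_sides fuv Ie (separates_sym ehu).
have nesu : ~ separates e u s.
  move=> eus; have nesv := free_sides fuv Ie eus.
  by have [?|?] := separates_split v esh (separates_neqr euv); sep_absurd.
have [sue|?] := separates_total suv euv (separates_neql esh); last by sep_absurd.
have [euhs|?] := separates_split _ (separates_sym ehu) hse; last by sep_absurd.
exact: (separates_trans sue euhs).1.
Qed.

(** On the connected arc from [s] to [t], the points moved right and the points moved left form two
    disjoint open sets, and without fixed points they cover it. *)
Lemma moves_right_transfer {u v} {h : T -> T} {s t} : free u v -> continuous h ->
  (forall y, between u v y -> h y <> y) -> between u v s -> between u v t ->
  separates s u (h s) -> separates t u (h t).
Proof.
move=> fuv ch nfix Is It suh.
have suv := fuv s Is.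
have uv := separates_neq suv.
have Iarc y : arc s t y -> between u v y.
  move=> [->//|[->//|yst]]; case: Is It => [Is Is'] [It It'].
  by split; [apply: same_side_convex Is It (nesym uv) yst|
             apply: same_side_convex Is' It' uv yst].
(* The bound [u] and [v] shadow the outer ones: [right_open v u] collects the points near which [h]
   moves the region to the left. *)
pose right_open u v : set T := [set y | exists N : set T,
  [/\ open N, N y & forall z, N z -> between u v z -> separates z u (h z)]].
have oR p q : open (right_open p q).
  rewrite openE => y [N [oN Ny HN]]; apply: (@filterS _ _ _ N).
    by move=> z Nz; exists N.
  exact: open_nbhs_nbhs.
have RE p q y : free p q -> between p q y -> right_open p q y <-> separates y p (h y).
  move=> fpq Iy; split=> [[N [_ Ny]]|]; first by apply.
  exact: moves_right_open.
pose B := [set y | arc s t y /\ separates y u (h y)].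
suff BE : B = arc s t by have [] : B t by (rewrite BE; right; left).
have dich y : between u v y -> separates y u (h y) <-> ~ separates y v (h y).
  move=> Iy; split=> [yuh /separates_sym|nyvh]; first exact: free_sides yuh.
  by have [//|?] := separates_split _ (fuv y Iy) (nfix y Iy); sep_absurd.
apply: arc_connected; first by exists s; split=> //; left.
- exists (right_open u v); first exact: oR.
  by apply/seteqP; split=> y [ay yuh]; split=> //; apply/(RE u v _ fuv (Iarc y ay)).
- exists (~` right_open v u); first exact: open_closedC.
  have ndich y : arc s t y -> separates y u (h y) <-> ~ right_open v u y.
    by move=> /Iarc Iy; rewrite (RE v u y (free_sym fuv) (between_sym Iy)) dich.
  by apply/seteqP; split=> y [ay yuh]; split=> //; apply/(ndich y ay).
Qed.

Lemma orbit_goes_right {u v} {f : T -> T} {x} : free u v -> transitive_point f x ->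
  between u v x -> exists n,
    [/\ (0 < n)%N, between u v (iter n f x) & separates x u (iter n f x)].
Proof.
move=> fuv tx Ix; have xuv := fuv x Ix.
have [t [txv It]] := separates_near (between_open u v) Ix (separates_neqr xuv).
have [xut|?] := separates_split _ xuv (nesym (separates_neql txv)); last by sep_absurd.
have oW : open (between u v `&` [set t | separates x t u]).
  by apply: openI; [exact: between_open|exact: open_opposite].
have [|n n0 [In xnu]] := tx _ oW _ 1%N; first by exists t; split=> //; exact: separates_sym.
by exists n; split=> //; exact: separates_sym.
Qed.

(** If [iter (n * k.+1) f] moves [x] right, it also moves [iter n f x] right, and [iter n f x] is
    already right of [x]. Only [iter n f x] has to stay in the region. *)
Lemma moves_right_multiple {u v} {f : T -> T} {x n} : free u v -> continuous f ->
  (forall y m, between u v y -> (0 < m)%N -> iter m f y <> y) ->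
  between u v x -> (0 < n)%N -> between u v (iter n f x) -> separates x u (iter n f x) ->
  forall k, separates x u (iter (n * k.+1) f x).
Proof.
move=> fuv cf nper Ix n0 In xun; elim=> [|k IH]; first by rewrite muln1.
have pk : (0 < n * k.+1)%N by rewrite muln_gt0 n0.
have nuh := moves_right_transfer fuv (continuous_iter f (n * k.+1) cf)
  (fun y Iy => nper y _ Iy pk) Ix In IH.
by rewrite mulnS addnC iterD; have [] := separates_trans xun nuh.
Qed.

Lemma free_periodic {u v} {f : T -> T} {x} : free u v -> continuous f ->
  transitive_point f x -> between u v x ->
  exists t n, [/\ between u v t, (0 < n)%N & iter n f t = t].
Proof.
move=> fuv cf tx Ix; apply: contrapT => H.
have nper y m : between u v y -> (0 < m)%N -> iter m f y <> y.
  by move=> Iy m0 my; apply: H; exists y, m.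
have [m [m0 Im xum]] := orbit_goes_right fuv tx Ix.
have [n [n0 In xvn]] := orbit_goes_right (free_sym fuv) tx (between_sym Ix).
(* The multiples are indexed by successors, so [n.-1] and [m.-1] yield the common exponent
   [m * n]. *)
have xu := moves_right_multiple fuv cf nper Ix m0 Im xum n.-1.
have xv := moves_right_multiple (free_sym fuv) cf
  (fun y k Iy => nper y k (between_sym Iy)) (between_sym Ix) n0 In xvn m.-1.
apply: (free_sides fuv Ix xu); rewrite prednK // mulnC -{1}(prednK m0).
exact: separates_sym.
Qed.

(** * Density of the periodic points *)

Lemma periodic_points_dense {f : T -> T} {x} : continuous f -> ~ endpoints T x ->
  closure (forward_orbit f x) = [set: T] -> dense (periodic_points f).
Proof.
move=> cf nex dx O [p Op] oO.
(* In a one-point space the only point is fixed. *)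
have [[q pq]|onept] := pselect (exists q, q <> p); last first.
  have allp y : y = p by apply: contrapT => yp; apply: onept; exists y.
  by exists p; split=> //; exists 1%N; split.
have tx := dense_orbit_transitive f x pq dx.
have [r [rpq prO]] := between_sub_nbhs oO Op pq.
have pr := separates_neql rpq.
suff [t [n [prt n0 tn]]] : exists t n, [/\ between p r t, (0 < n)%N & iter n f t = t].
  by exists t; split; [exact: prO|exists n].
have [fpr|nfpr] := pselect (free p r).
  have [t tpr] := sepT _ _ pr.
  have It : between p r t.
    split; split; [exact: nesym (separates_neql tpr)| |exact: nesym (separates_neqr tpr)|].
      by move=> ?; sep_absurd.
    by move=> ?; sep_absurd.
  have [k _ Ik] := tx _ (between_open p r) (ex_intro _ t It) 0%N.
  exact: free_periodic fpr cf (transitive_point_iter f x k tx) Ik.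
have [y [Iy nypr]] : exists y, between p r y /\ ~ separates y p r.
  apply: contrapT => H; apply: nfpr => y Iy; apply: contrapT => nypr.
  by apply: H; exists y.
have [c [cyp Qr]] := same_side_branch Iy.1.1 Iy.2.1 nypr.
(* A point that is not an endpoint is a cut point. *)
have [a [b xab]] : exists a b, separates x a b.
  apply: contrapT => ncut; apply: nex.
  have [z zx] : exists z, z <> x.
    have [px|px] := pselect (p = x); first by exists q; rewrite -px.
    by exists p.
  by apply: (noncut_endpoint zx) => a b xab; apply: ncut; exists a, b.
have [t [n [n0 tn tc]]] := branch_periodic pq cf tx xab cyp.
by exists t, n; split=> //; exact: between_branch Iy cyp Qr tc.
Qed.

End Dendrite.

Theorem theorem3p5 (R : realType) (D : metricType R) (f : D -> D) :
  dendrite D -> continuous f ->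
  (exists x : D, ~ endpoints D x /\ closure (forward_orbit f x) = [set: D]) ->
  dense (periodic_points f).
Proof.
move=> [[cD connD _] sepD] cf [x [nex dx]].
apply: (periodic_points_dense _ connD cD sepD cf nex dx).
exact/accessible_closed_set1/hausdorff_accessible/metric_hausdorff.
Qed.
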